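(* Let $(X,\mathcal{A},\mu)$ be a measure space and let $I$ be an ideal of the ring $\mathcal{M}(X,\mathcal{A})$. Then $L_I^\infty(\mu)$ is a clopen (closed and open) subset of $\mathcal{M}(X,\mathcal{A})$ in the $m_{\mu_I}$-topology.
   Context: $X$ is a non-empty set, $\mathcal{A}$ a $\sigma$-algebra on $X$, and $\mu:\mathcal{A}\to[0,\infty]$ a measure. $\mathcal{M}(X,\mathcal{A})$ is the commutative ring with unity of all real-valued $\mathcal{A}$-measurable functions on $X$, with pointwise operations. For $g\in\mathcal{M}(X,\mathcal{A})$, $Z(g)=\{x\in X: g(x)=0\}$, and for an ideal $I$, $Z[I]=\{Z(g): g\in I\}$. Null sets $E$ below are always members of $\mathcal{A}$. $L_I^\infty(\mu)$ is the set of all $f\in\mathcal{M}(X,\mathcal{A})$ for which there exist $Z\in Z[I]$ and $E\subseteq Z$ with $\mu(E)=0$ such that $f$ is bounded on $Z\setminus E$. $U_{\mu_I}^+$ is the set of all $u\in\mathcal{M}(X,\mathcal{A})$ for which there exist $Z\in Z[I]$ and $E\subseteq Z$ with $\mu(E)=0$ such that $u(x)>0$ for all $x\in Z\setminus E$. For $f\in\mathcal{M}(X,\mathcal{A})$ and $u\in U_{\mu_I}^+$, $m_{\mu_I}(f,u)$ is the set of all $g\in\mathcal{M}(X,\mathcal{A})$ for which there exist $Z\in Z[I]$ and $E\subseteq Z$ with $\mu(E)=0$ such that $|g(x)-f(x)|<u(x)$ for all $x\in Z\setminus E$. The sets $m_{\mu_I}(f,u)$ ($f\in\mathcal{M}(X,\mathcal{A})$,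 $u\in U_{\mu_I}^+$) form an open base for a topology on $\mathcal{M}(X,\mathcal{A})$, called the $m_{\mu_I}$-topology. *)

(* Defs.v *)
From HB Require Import structures.
From mathcomp Require Import all_boot all_order all_algebra.
From mathcomp Require Import all_classical all_reals all_analysis.
From mathcomp Require Import measurable_realfun.

Set Implicit Arguments.
Unset Strict Implicit.
Unset Printing Implicit Defensive.

Import Order.TTheory GRing.Theory Num.Theory.
Import numFieldNormedType.Exports.

Local Open Scope classical_set_scope.
Local Open Scope ring_scope.

(* Unlike [idealr] of MathComp's ring_quotient, ideals need not be proper. *)
Definition is_ideal (A : comNzRingType) (I : set A) : Prop :=
  [/\ I 0, forall a b, I a -> I b -> I (a + b) & forall r a, I a -> I (r * a)].

Section Definitions.
Context d (T : measurableType d) (R : realType).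
Implicit Types (mu : {measure set T -> \bar R}) (I : set {mfun T >-> R}).
Implicit Types (f g u : {mfun T >-> R}).

Definition zero_set g : set T := [set x | g x = 0].

Definition zero_sets I : set (set T) := [set zero_set g | g in I].

(* [Q] holds for some Z \ E with Z in Z[I] and E a measurable null subset of Z. *)
Definition on_zero_set_ae mu I (Q : set T -> Prop) : Prop :=
  exists Z E : set T,
    [/\ zero_sets I Z, measurable E, mu E = 0%E, E `<=` Z & Q (Z `\` E)].

Definition Linfty_ideal mu I : set {mfun T >-> R} :=
  [set f : {mfun T >-> R} |
    on_zero_set_ae mu I (fun A => [bounded f x | x in A])].

Definition U_pos mu I : set {mfun T >-> R} :=
  [set u : {mfun T >-> R} |
    on_zero_set_ae mu I (fun A => forall x, A x -> 0 < u x)].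

Definition m_ball mu I f u : set {mfun T >-> R} :=
  [set g : {mfun T >-> R} |
    on_zero_set_ae mu I (fun A => forall x, A x -> `|g x - f x| < u x)].

Definition m_base mu I : set (set {mfun T >-> R}) :=
  [set m_ball mu I f u | f in [set: {mfun T >-> R}] & u in U_pos mu I].

Lemma on_zero_set_aeI mu I (P Q : T -> Prop) : is_ideal I ->
  on_zero_set_ae mu I (fun A => forall x, A x -> P x) ->
  on_zero_set_ae mu I (fun A => forall x, A x -> Q x) ->
  on_zero_set_ae mu I (fun A => forall x, A x -> P x /\ Q x).
Proof.
move=> [I0 ID IM] [_ [E1 [[g1 Ig1 <-] mE1 E10 sE1 P1]]].
move=> [_ [E2 [[g2 Ig2 <-] mE2 E20 sE2 P2]]].
have zE : zero_set (g1 * g1 + g2 * g2) = zero_set g1 `&` zero_set g2.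
  apply/seteqP; split=> x.
    move=> h; have : g1 x * g1 x + g2 x * g2 x = 0 by exact: h.
    move/eqP; rewrite -!expr2 paddr_eq0 ?sqr_ge0 // !sqrf_eq0.
    by move=> /andP[/eqP h1 /eqP h2]; split.
  move=> [h1 h2]; suff : g1 x * g1 x + g2 x * g2 x = 0 by [].
  by rewrite h1 h2 mulr0 addr0.
have mz g : measurable (zero_set g).
  have := measurable_funPT g measurableT _ (measurable_set1 (0 : R)).
  by rewrite setTI.
pose Z := zero_set (g1 * g1 + g2 * g2).
exists Z, (Z `&` (E1 `|` E2)); split.
- by exists (g1 * g1 + g2 * g2) => //; apply: ID; exact: IM.
- by apply: measurableI; [exact: mz|exact: measurableU].
- have mE := measurableU _ _ mE1 mE2.
  apply: (subset_measure0 _ mE (@subIsetr _ _ _)).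
    by apply: measurableI => //; exact: mz.
  exact: null_set_setU.
- exact: subIsetl.
- move=> x [Zx nE]; have := Zx; rewrite /Z zE => -[z1 z2].
  by split; [apply: P1|apply: P2]; split=> // Ex; apply: nE;
    split=> //; [left|right].
Qed.

Lemma on_zero_set_aeW mu I (P Q : T -> Prop) : (forall x, P x -> Q x) ->
  on_zero_set_ae mu I (fun A => forall x, A x -> P x) ->
  on_zero_set_ae mu I (fun A => forall x, A x -> Q x).
Proof.
by move=> PQ [Z [E [? ? ? ? h]]]; exists Z, E; split=> // x /h /PQ.
Qed.

Lemma m_ball_center mu I f u : U_pos mu I u -> m_ball mu I f u f.
Proof.
by apply: on_zero_set_aeW => x; rewrite subrr normr0.
Qed.

Lemma m_base_cover mu I : is_ideal I ->
  \bigcup_(V in m_base mu I) V = [set: {mfun T >-> R}].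
Proof.
move=> [I0 _ _]; apply/seteqP; split=> // f _.
have U1 : U_pos mu I 1.
  exists setT, set0; split=> //.
  by exists 0 => //; apply/seteqP; split.
by exists (m_ball mu I f 1); [exists f => //; exists 1|exact: m_ball_center].
Qed.

Lemma m_base_join mu I : is_ideal I -> forall V W g, m_base mu I V ->
  m_base mu I W -> V g -> W g ->
  exists B, [/\ m_base mu I B, B g & B `<=` V `&` W].
Proof.
move=> hI _ _ g [f1 _ [u1 Uu1 <-]] [f2 _ [u2 Uu2 <-]] g1 g2.
have mh f u : measurable_fun setT (fun x => u x - `|g x - f x|).
  apply: measurable_funB; first exact: measurable_funPT.
  apply: measurableT_comp => //.
  by apply: measurable_funB; exact: measurable_funPT.
have mu_ : measurable_fun setT (fun x => Num.min (u1 x - `|g x - f1 x|)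
    (u2 x - `|g x - f2 x|)) by exact: measurable_minr.
pose u : {mfun T >-> R} := HB.pack (fun x => Num.min (u1 x - `|g x - f1 x|)
  (u2 x - `|g x - f2 x|)) (isMeasurableFun.Build _ _ _ _ _ mu_).
have Uu : U_pos mu I u.
  apply: on_zero_set_aeW (on_zero_set_aeI hI g1 g2) => x [h1 h2].
  by rewrite /u /= lt_min !subr_gt0 h1.
exists (m_ball mu I g u); split; first by exists g => //; exists u.
- exact: m_ball_center.
- move=> h hg.
  split; apply: on_zero_set_aeW hg => x; rewrite /u /= lt_min => /andP[h1 h2].
  + have := ler_distD (g x) (h x) (f1 x); rewrite ltrBrDr in h1.
    by move=> /le_lt_trans; exact.
  + have := ler_distD (g x) (h x) (f2 x); rewrite ltrBrDr in h2.
    by move=> /le_lt_trans; exact.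
Qed.

(* Alias of the ring of measurable functions carrying the topology with open
   base [m_base mu I]. *)
Definition m_space mu I (hI : is_ideal I) : Type := {mfun T >-> R}.

Section Topology.
Variables (mu : {measure set T -> \bar R}) (I : set {mfun T >-> R}).
Variable hI : is_ideal I.

HB.instance Definition _ := Choice.on (m_space mu hI).
HB.instance Definition _ := isBaseTopological.Build (m_space mu hI)
  (m_base_cover mu hI) (m_base_join (mu := mu) hI).

Lemma m_space_openE :
  @open (m_space mu hI) =
  [set \bigcup_(V in D) V | D in [set D | D `<=` m_base mu I]].
Proof. by []. Qed.

End Topology.

End Definitions.

(* Main.v *)
Require Import Defs.
From mathcomp Require Import all_boot all_order all_algebra.
From mathcomp Require Import all_classical all_reals all_analysis.
From mathcomp Require Import measurable_realfun.

Import Order.TTheory GRing.Theory Num.Theory.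
Import numFieldNormedType.Exports.

Local Open Scope classical_set_scope.
Local Open Scope ring_scope.

(** The constant function 1 is an admissible radius, and lying in the ball of
    radius 1 around each other is a symmetric relation on functions
    ([m_ball_sym]). By the triangle inequality, a function within 1 of an
    essentially bounded one is essentially bounded ([Linfty_ideal_unit_ball]);
    by symmetry, a function within 1 of one that is not essentially bounded is
    not essentially bounded either. Hence both the essentially bounded functions
    and their complement contain the unit ball around each of their points, so
    both are unions of basic open sets ([open_unit_ball_saturated]). *)

Section UnitBalls.
Set Implicit Arguments.
Unset Strict Implicit.

Context {d : measure_display} {T : measurableType d} {R : realType}.
Variables (mu : {measure set T -> \bar R}) (I : set {mfun T >-> R}).
Implicit Types (f g : {mfun T >-> R}) (S : set {mfun T >-> R}).

Lemma U_pos1 : is_ideal I -> U_pos mu I 1.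
Proof.
move=> [I0 _ _]; exists setT, set0; split=> //.
by exists 0 => //; apply/seteqP; split.
Qed.

Lemma m_ball_sym f g u : m_ball mu I f u g -> m_ball mu I g u f.
Proof. by apply: on_zero_set_aeW => x; rewrite distrC. Qed.

(** Fixing the bound turns boundedness into a pointwise condition, so that
    [on_zero_set_aeI] can combine it with the closeness of two functions, which
    holds on another zero set minus another null set. *)
Lemma Linfty_idealP f : Linfty_ideal mu I f <->
  exists M : R, on_zero_set_ae mu I (fun A => forall x, A x -> `|f x| <= M).
Proof.
split=> [[Z [E [IZ mE E0 EZ [M [_ fM]]]]]|[M [Z [E [IZ mE E0 EZ fM]]]]].
  (* Near +oo, boundedness only provides the bounds strictly above M. *)
  exists (M + 1), Z, E; split=> //.
  by apply: fM; rewrite ltrDl.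
exists Z, E; split=> //; exists M; split; first exact: num_real.
by move=> N MN x /fM /le_trans; apply; exact: ltW.
Qed.

Lemma Linfty_ideal_unit_ball f g : is_ideal I ->
  m_ball mu I f 1 g -> Linfty_ideal mu I f -> Linfty_ideal mu I g.
Proof.
move=> hI fg /Linfty_idealP[M fM]; apply/Linfty_idealP; exists (1 + M).
apply: on_zero_set_aeW (on_zero_set_aeI hI fg fM) => x [gf1 fxM].
rewrite -[g x](subrK (f x)).
exact: le_trans (ler_normD _ _) (lerD (ltW gf1) fxM).
Qed.

Lemma open_unit_ball_saturated (hI : is_ideal I) S :
  (forall f g, m_ball mu I f 1 g -> S f -> S g) -> open (S : set (m_space mu hI)).
Proof.
move=> satS; rewrite m_space_openE.
exists [set m_ball mu I f 1 | f in S].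
  by move=> _ [f _ <-]; exists f => //; exists 1 => //; exact: U_pos1.
apply/seteqP; split=> [g [_ [f Sf <-] fg]|f Sf]; first exact: satS fg Sf.
by exists (m_ball mu I f 1); [exists f|exact/m_ball_center/U_pos1].
Qed.

End UnitBalls.

Theorem theorem2p2 (d : measure_display) (T : measurableType d) (R : realType)
    (mu : {measure set T -> \bar R}) (I : set {mfun T >-> R})
    (hI : is_ideal I) :
  clopen (Linfty_ideal mu I : set (m_space mu hI)).
Proof.
split; last rewrite -openC.
  by apply: open_unit_ball_saturated => f g; exact: Linfty_ideal_unit_ball hI.
apply: open_unit_ball_saturated => f g fg nf Lg; apply: nf.
exact: Linfty_ideal_unit_ball hI (m_ball_sym fg) Lg.
Qed.
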